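(* The bi-nuclear norm $\|\cdot\|_{\mathrm{BiN}}$ is a quasi-norm on $\mathbb{R}^{m\times n}$. In addition, it is the Schatten-$1/2$ quasi-norm: for every $X\in\mathbb{R}^{m\times n}$ and every integer $d\ge \mathrm{rank}(X)$ used in its definition, $$\|X\|_{\mathrm{BiN}}=\|X\|_{S_{1/2}}.$$
   Context: $\sigma_i(X)$ denotes the $i$-th singular value of $X\in\mathbb{R}^{m\times n}$. For $0<p<\infty$, $\|X\|_{S_p}=\left(\sum_{i=1}^{\min(m,n)}\sigma_i(X)^p\right)^{1/p}$. The nuclear norm is $\|X\|_*=\sum_i\sigma_i(X)$. Definition (bi-nuclear norm). For $X\in\mathbb{R}^{m\times n}$ with $\mathrm{rank}(X)=r\le d$, $$\|X\|_{\mathrm{BiN}}:=\min\left\{\|U\|_*\|V\|_* : U\in\mathbb{R}^{m\times d},\ V\in\mathbb{R}^{n\times d},\ X=UV^T\right\}.$$ A function $N:\mathbb{R}^{m\times n}\to[0,\infty)$ is a quasi-norm if $N(X)=0$ only for $X=0$, $N(aX)=|a|N(X)$ for all $a\in\mathbb{R}$, and there is a constant $\beta\ge1$ with $N(X+Y)\le\beta(N(X)+N(Y))$ for all $X,Y$. *)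

(* Defs.v *)
From HB Require Import structures.
From mathcomp Require Export all_boot all_order all_algebra.
From mathcomp Require Export polyrcf.
From mathcomp Require Export all_classical all_reals all_analysis.

Set Implicit Arguments.
Unset Strict Implicit.
Unset Printing Implicit Defensive.

Import Order.TTheory GRing.Theory Num.Theory.
Local Open Scope classical_set_scope.
Local Open Scope ring_scope.

(* The real roots of the characteristic polynomial of A, each repeated
   according to its algebraic multiplicity, in nonincreasing order. For
   symmetric A this list has length n. *)
Definition real_eigenvalues (R : realType) (n : nat) (A : 'M[R]_n) : seq R :=
  sort >=%R
    (flatten [seq nseq (mup x (char_poly A)) x | x <- rootsR (char_poly A)]).

(* Indices start at 0: [singular_value X 0] is the largest singular value. *)
Definition singular_value (R : realType) (m n : nat) (X : 'M[R]_(m, n))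
    (i : nat) : R :=
  Num.sqrt (nth 0 (real_eigenvalues (X^T *m X)) i).

Definition nuclear_norm (R : realType) (m n : nat) (X : 'M[R]_(m, n)) : R :=
  \sum_(i < minn m n) singular_value X i.

(* Meant for 0 < p. *)
Definition schatten (R : realType) (p : R) (m n : nat) (X : 'M[R]_(m, n)) : R :=
  (\sum_(i < minn m n) singular_value X i `^ p) `^ p^-1.

Definition bin_products (R : realType) (m n d : nat) (X : 'M[R]_(m, n)) :
    set R :=
  [set x | exists (U : 'M[R]_(m, d)) (V : 'M[R]_(n, d)),
     X = U *m V^T /\ x = nuclear_norm U * nuclear_norm V].

Definition is_minimum (R : realType) (A : set R) (x : R) : Prop :=
  A x /\ (forall y, A y -> x <= y).

(* [inf] is total; whether it is attained, so that it is a minimum, is the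
   separate assertion [is_minimum (bin_products d X) (bin_norm d X)]. *)
Definition bin_norm (R : realType) (m n d : nat) (X : 'M[R]_(m, n)) : R :=
  inf (bin_products d X).

Definition quasi_norm (R : realType) (m n : nat) (N : 'M[R]_(m, n) -> R) :
    Prop :=
  [/\ forall X, 0 <= N X,
      forall X, N X = 0 -> X = 0,
      forall (a : R) X, N (a *: X) = `|a| * N X
    & exists2 beta : R, 1 <= beta &
        forall X Y, N (X + Y) <= beta * (N X + N Y)].

(* Main.v *)
Require Import Defs.
From mathcomp Require Import all_boot all_order all_algebra.
From mathcomp Require Import complex.
From mathcomp Require Import all_classical all_reals all_analysis.
From mathcomp Require Import ring lra.

(* Lower bound: let X = U V^T have singular triples (p_i, s_i, q_i) with
   s_i > 0, and let U = H W be a polar decomposition, so that H is positive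
   semidefinite with trace ||U||_* and W is a contraction. For
   y_i := W V^T q_i one has H y_i = s_i p_i, and the Cauchy-Schwarz inequality
   for the form of H gives s_i <= <p_i, H p_i> <p_i, y_i>. Summing square roots
   with Cauchy-Schwarz once more bounds (sum_i sqrt s_i)^2 by
   (sum_i <p_i, H p_i>) (sum_i <p_i, W V^T q_i>) <= ||U||_* ||V||_*, the last
   step by duality of the nuclear norm with the spectral norm.
   Equality holds for U = P sqrt(S) E and V = Q sqrt(S) E, where X = P S Q^T is
   a thin singular value decomposition and E has orthonormal rows.
   Quasi-triangle inequality: concatenating optimal factorizations gives
   X + Y = [U1 U2] [V1 V2]^T, whence the constant 2. *)

Import Order.TTheory GRing.Theory Num.Theory.

Set Implicit Arguments.
Unset Strict Implicit.
Unset Printing Implicit Defensive.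

Local Open Scope ring_scope.

(** * Real eigenvalues and characteristic polynomials *)

(** The spectral theorem diagonalizes [S] over the complex numbers; the spectrum is real because [S]
    becomes hermitian, and not all zero because [S] is not. Roots of the characteristic polynomial
    descend along the embedding of [R]. *)
Lemma sym_neq0_eigenvalue (R : realType) (n : nat) (S : 'M[R]_n) :
  S^T = S -> S != 0 -> exists2 a, a != 0 & eigenvalue S a.
Proof.
move=> Ssym S0; pose SC := map_mx (real_complex R) S.
have SCreal : SC \is a realmx.
  by apply/mxOverP => i j; rewrite mxE; apply/complex_realP; exists (S i j).
have SCsym : SC \is symmetricmx.
  by apply/is_hermitianmxP; rewrite expr0 scale1r map_mx_id// /SC map_trmx Ssym.
have SCnormal := symmetric_normalmx SCsym SCreal.
have SCE := orthomx_spectralP SCnormal.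
have /mxOverP diag_real :=
  hermitian_spectral_diag_real (realsym_hermsym SCsym SCreal).
set P := spectralmx SC in SCE; set sp := spectral_diag SC in SCE diag_real.
have Pu : P \in unitmx by exact: spectral_unit.
have [i spi0] : exists i, sp 0 i != 0.
  apply/existsP; apply: contraNT S0 => /existsPn sp0.
  have : SC = 0.
    rewrite SCE (_ : diag_mx sp = 0) ?mulmx0 ?mul0mx//.
    apply/matrixP => j k; rewrite !mxE.
    by have /negPn/eqP -> := sp0 j; rewrite mul0rn.
  by move=> /eqP; rewrite map_mx_eq0.
have /complex_realP[a spiE] := diag_real 0 i.
exists a; first by move: spi0; rewrite spiE (inj_eq (@complexI R) a 0).
rewrite eigenvalue_root_char -(fmorph_root (real_complex R)).
rewrite map_char_poly -eigenvalue_root_char; apply/eigenvalueP.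
exists (row i P).
  rewrite -/SC {1}SCE !mulmxA -row_mul mulmxV// row1 -rowE row_diag_mx.
  by rewrite -scalemxAl -rowE spiE.
apply/eqP => rowP0; have := congr1 (mulmx^~ (invmx P)) rowP0.
rewrite -row_mul mulmxV// row1 mul0mx => /matrixP/(_ 0 i)/eqP.
by rewrite !mxE !eqxx oner_eq0.
Qed.

(** Sylvester's identity: clearing the lower left block of [M] by a column operation and by a row
    operation computes its determinant in two ways. *)
Lemma char_poly_mulmxC (R : comNzRingType) (m n : nat)
    (A : 'M[R]_(m, n)) (B : 'M[R]_(n, m)) :
  'X^n * char_poly (A *m B) = 'X^m * char_poly (B *m A).
Proof.
rewrite /char_poly /char_poly_mx !map_mxM.
set A' := map_mx _ A; set B' := map_mx _ B.
pose M := block_mx 'X%:M A' B' 1%:M.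
have detAB : \det M = \det ('X%:M - A' *m B').
  transitivity (\det (M *m block_mx 1%:M 0 (- B') 1%:M)).
    by rewrite det_mulmx det_lblock !det1 !mulr1.
  rewrite mulmx_block !mulmx1 !mulmx0 !mulmxN mul1mx subrr !add0r.
  by rewrite det_ublock det1 mulr1.
transitivity (\det (block_mx 1%:M 0 (- B') 'X%:M *m M)).
  by rewrite det_mulmx det_lblock det1 det_scalar mul1r detAB.
rewrite mulmx_block !mul1mx !mul0mx !addr0 mulmx1 !mulNmx.
by rewrite scalar_mxC addNr det_ublock det_scalar addrC.
Qed.

Lemma real_eigenvalues_prod_XsubC (R : realType) (n : nat) (A : 'M[R]_n)
    (s : seq R) :
  char_poly A = \prod_(x <- s) ('X - x%:P) ->
  real_eigenvalues A = sort >=%R s.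
Proof.
move=> charA.
have char0 : char_poly A != 0 by rewrite monic_neq0// char_poly_monic.
apply/perm_sortP.
- exact: ge_total.
- exact: ge_trans.
- exact: ge_anti.
apply/allP => x _ /=; apply/eqP.
rewrite -(mu_prod_XsubC x s) -charA count_flatten -map_comp sumnE big_map.
under eq_bigr => y _ do rewrite /= count_nseq /=.
have [xr|xr] := boolP (x \in rootsR (char_poly A)).
  rewrite (bigD1_seq x)//= ?eqxx ?mul1n ?big1 ?addn0//.
  2: exact: polyrcf.uniq_roots.
  by move=> y /negPf ->.
rewrite big1_seq => [|y /= yr]; last first.
  by rewrite (_ : y == x = false)//; apply: contraNF xr => /eqP <-.
rewrite mupNroot//; apply: contra xr => rx.
by rewrite -roots_on_rootsR ?rx ?in_itv.
Qed.

(** * Singular values read off a thin decomposition *)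

(** No order is imposed on [s], and zero entries are allowed, so that scaling [s] by 0 still gives a
    decomposition. *)
Definition is_svd (R : realType) (m n r : nat) (A : 'M[R]_(m, n))
    (P : 'M[R]_(m, r)) (s : 'rV[R]_r) (Q : 'M[R]_(n, r)) : Prop :=
  [/\ P^T *m P = 1%:M, Q^T *m Q = 1%:M, forall i, 0 <= s 0 i
    & A = P *m diag_mx s *m Q^T].

Lemma orthonormal_leq (R : fieldType) (m r : nat) (P : 'M[R]_(m, r)) :
  P^T *m P = 1%:M -> (r <= m)%N.
Proof. by move=> PP; rewrite -(mxrank1 R r) -PP mulmx_max_rank. Qed.

Lemma svd_gram (R : realType) (m n r : nat) (A : 'M[R]_(m, n))
    (P : 'M[R]_(m, r)) (s : 'rV[R]_r) (Q : 'M[R]_(n, r)) :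
  is_svd A P s Q ->
  A^T *m A = Q *m (diag_mx (\row_i (s 0 i ^+ 2)) *m Q^T).
Proof.
case=> PP QQ _ ->; rewrite !trmx_mul trmxK tr_diag_mx.
have -> : diag_mx (\row_i (s 0 i ^+ 2)) = diag_mx s *m diag_mx s.
  rewrite mul_diag_mx; apply/matrixP => i j; rewrite !mxE.
  by case: eqP => [->|]; rewrite ?mulr0// expr2.
by rewrite !mulmxA -(mulmxA _ P^T) PP mulmx1.
Qed.

(** Exchanging the factors of the Gram matrix reduces its characteristic polynomial to that of the
    diagonal matrix of squares, up to [n - r] zero roots; these can be listed last since squares are
    nonnegative. *)
Lemma real_eigenvalues_svd (R : realType) (m n r : nat) (A : 'M[R]_(m, n))
    (P : 'M[R]_(m, r)) (s : 'rV[R]_r) (Q : 'M[R]_(n, r)) :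
  is_svd A P s Q ->
  real_eigenvalues (A^T *m A) =
    sort >=%R [seq s 0 i ^+ 2 | i <- enum 'I_r] ++ nseq (n - r) 0.
Proof.
move=> svdA; have [PP QQ s0 _] := svdA.
have rn := orthonormal_leq QQ.
set L := [seq _ | _ <- _].
have charA : char_poly (A^T *m A) =
    \prod_(x <- L ++ nseq (n - r) 0) ('X - x%:P).
  have Xr0 : 'X^r != 0 :> {poly R} by rewrite monic_neq0// monicXn.
  apply: (mulfI Xr0); rewrite (svd_gram svdA) char_poly_mulmxC -mulmxA QQ mulmx1.
  rewrite char_poly_trig ?diag_mx_is_trig//.
  rewrite big_cat /= [X in _ = _ * (_ * X)]big_nseq subr0 iter_mulr_1.
  rewrite mulrCA mulrC -exprD subnKC//; congr (_ * _).
  rewrite big_map big_enum /=; apply: eq_bigr => i _.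
  by rewrite !mxE eqxx mulr1n.
rewrite (real_eigenvalues_prod_XsubC charA).
apply: (@sorted_eq _ >=%R).
- exact: ge_trans.
- exact: ge_anti.
- exact/sort_sorted/ge_total.
- rewrite sorted_pairwise; last exact: ge_trans.
  rewrite pairwise_cat -!sorted_pairwise; try exact: ge_trans.
  rewrite sort_sorted ?andbT/=; last exact: ge_total.
  apply/andP; split.
    apply/allrelP => x y; rewrite mem_sort mem_nseq => /mapP[i _ ->].
    by move=> /andP[_ /eqP ->]; exact: sqr_ge0.
  by elim: (n - r)%N => //= -[//|k] /= ->; rewrite lexx.
by rewrite perm_sort perm_sym perm_cat2r perm_sort.
Qed.

(** The condition [f 0 = 0] hides the singular values beyond the first [r]. A general [f] serves
    both the nuclear norm and the Schatten sum. *)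
Lemma sum_singular_value_svd (R : realType) (m n r : nat) (A : 'M[R]_(m, n))
    (P : 'M[R]_(m, r)) (s : 'rV[R]_r) (Q : 'M[R]_(n, r)) (f : R -> R) :
  f 0 = 0 -> is_svd A P s Q ->
  \sum_(i < minn m n) f (singular_value A i) = \sum_(i < r) f (s 0 i).
Proof.
move=> f0 svdA; have [PP QQ s0 _] := svdA.
set L := [seq s 0 i ^+ 2 | i <- enum 'I_r].
have szL : size (sort >=%R L) = r by rewrite size_sort size_map size_enum_ord.
have rmn : (r <= minn m n)%N.
  by rewrite leq_min (orthonormal_leq PP) (orthonormal_leq QQ).
transitivity (\sum_(0 <= i < minn m n) f (Num.sqrt (nth 0 (sort >=%R L) i))).
  rewrite big_mkord; apply: eq_bigr => i _.
  rewrite /singular_value (real_eigenvalues_svd svdA) nth_cat nth_nseq if_same.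
  by case: ltnP => // ?; rewrite nth_default.
rewrite (@big_cat_nat _ _ _ r)//= [X in _ + X]big1_seq ?addr0; last first.
  move=> i; rewrite mem_index_iota => /andP[_ /andP[ri _]].
  by rewrite nth_default ?szL// sqrtr0.
rewrite -{1}szL -(big_nth 0 xpredT (fun x => f (Num.sqrt x))).
rewrite (perm_big L) ?perm_sort//= big_map big_enum /=.
by apply: eq_bigr => i _; rewrite sqrtr_sqr ger0_norm.
Qed.

(** * Cauchy-Schwarz and existence of singular value decompositions *)

Lemma CauchySchwarz_sum (R : realFieldType) (I : finType) (a b : I -> R) :
  (\sum_i a i * b i) ^+ 2 <= (\sum_i a i ^+ 2) * (\sum_i b i ^+ 2).
Proof.
set A := \sum_i a i ^+ 2; set B := \sum_i b i ^+ 2; set C := \sum_i a i * b i.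
have B0 : 0 <= B by apply: sumr_ge0 => i _; exact: sqr_ge0.
have key : 0 <= B * (A * B - C ^+ 2).
  have -> : B * (A * B - C ^+ 2) = \sum_i (B * a i - C * b i) ^+ 2.
    under eq_bigr => i _.
      rewrite (_ : _ ^+ 2 = B ^+ 2 * a i ^+ 2 + (- (2 * B * C)) * (a i * b i)
                            + C ^+ 2 * b i ^+ 2); last by ring.
      over.
    by rewrite !big_split -!mulr_sumr -/A -/B -/C /=; ring.
  by apply: sumr_ge0 => i _; exact: sqr_ge0.
have [B_eq0|B_neq0] := eqVneq B 0.
  rewrite B_eq0 mulr0 /C big1 ?expr0n// => i _.
  have /eqP := B_eq0; rewrite psumr_eq0 => [/allP/(_ i)|j _]; last exact: sqr_ge0.
  by rewrite mem_index_enum sqrf_eq0 => /(_ isT) /eqP ->; rewrite mulr0.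
have Bp : 0 < B by rewrite lt0r B_neq0.
by move: key; rewrite pmulr_rge0// subr_ge0.
Qed.

Lemma gram_eq0 (R : realFieldType) (m n : nat) (A : 'M[R]_(m, n)) :
  A^T *m A = 0 -> A = 0.
Proof.
move=> AA; apply/matrixP => i j; rewrite mxE.
have /matrixP/(_ j j)/eqP := AA; rewrite !mxE psumr_eq0 => [|k _].
  move=> /allP/(_ i); rewrite mem_index_enum mxE -expr2 sqrf_eq0.
  by move=> /(_ isT)/eqP.
by rewrite mxE -expr2 sqr_ge0.
Qed.

Lemma diag_mx_mul_eq0 (R : idomainType) (r k : nat) (s : 'rV[R]_r)
    (A : 'M[R]_(r, k)) :
  (forall i, s 0 i != 0) -> diag_mx s *m A = 0 -> A = 0.
Proof.
move=> s0; rewrite mul_diag_mx => /matrixP sA; apply/matrixP => i j.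
by have /eqP := sA i j; rewrite !mxE mulf_eq0 (negPf (s0 i)) => /eqP.
Qed.

(* Deflation: a singular triple (p, sqrt a, q) of A with a > 0 is split off,
   which lowers the rank and leaves a matrix killed by q and by p^T. *)
Lemma svd_exists (R : realType) (m n : nat) (A : 'M[R]_(m, n)) :
  exists r (P : 'M[R]_(m, r)) (s : 'rV[R]_r) (Q : 'M[R]_(n, r)),
    (forall i, 0 < s 0 i) /\ is_svd A P s Q.
Proof.
have [k] := ubnP (\rank A); elim: k A => // k IH A rkA.
have [->|A0] := eqVneq A 0.
  exists 0, 0, 0, 0; split; first by case=> [[]].
  split; [| |by case=> [[]]|by rewrite !mul0mx].
  - by rewrite mulmx0; apply/matrixP; case.
  - by rewrite mulmx0; apply/matrixP; case.
have [a a0 /eigenvalueP[v vA v0]] : exists2 a, a != 0 & eigenvalue (A^T *m A) a.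
  apply: sym_neq0_eigenvalue; first by rewrite trmx_mul trmxK.
  by apply: contraNneq A0 => /gram_eq0 ->.
pose nv := (v *m v^T) 0 0.
have nv0 : 0 < nv.
  rewrite lt0r; apply/andP; split; last first.
    by rewrite /nv mxE sumr_ge0// => i _; rewrite mxE -expr2 sqr_ge0.
  apply: contraNneq v0 => nv0; rewrite -trmx_eq0; apply/eqP/gram_eq0.
  by rewrite trmxK [LHS]mx11_scalar -/nv nv0 raddf0.
pose q := (Num.sqrt nv)^-1 *: v.
have qq : q *m q^T = 1%:M.
  rewrite /q linearZ /= -scalemxAl -scalemxAr scalerA -invfM -expr2.
  rewrite sqr_sqrtr ?ltW// [v *m _]mx11_scalar -/nv -scalemx1 scalerA.
  by rewrite mulVf ?gt_eqF// scale1r.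
have qA : q *m (A^T *m A) = a *: q.
  by rewrite /q -scalemxAl vA !scalerA mulrC.
have aE : (A *m q^T)^T *m (A *m q^T) = a%:M.
  by rewrite trmx_mul trmxK !mulmxA -(mulmxA q) qA -scalemxAl qq scalemx1.
(* By [aE], [a] is the squared length of [A *m q^T]. *)
have a_gt0 : 0 < a.
  rewrite lt0r a0; have /matrixP/(_ 0 0) := aE.
  rewrite !mxE eqxx mulr1n => <-; rewrite sumr_ge0// => i _.
  by rewrite mxE -expr2 sqr_ge0.
pose c := Num.sqrt a; have c0 : 0 < c by rewrite sqrtr_gt0.
have cc : c * c = a by rewrite -expr2 sqr_sqrtr// ltW.
pose p := c^-1 *: (A *m q^T).
have pp : p^T *m p = 1%:M.
  rewrite /p [X in X *m _]linearZ /= -scalemxAl -scalemxAr aE scalerA -invfM cc.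
  by rewrite scale_scalar_mx mulVf.
have pA : p^T *m A = c *: q.
  rewrite /p linearZ /= trmx_mul trmxK -scalemxAl -mulmxA qA scalerA -cc.
  by rewrite mulrA mulVf ?mul1r// gt_eqF.
pose B := A - c *: (p *m q).
have Bq : B *m q^T = 0.
  rewrite /B mulmxBl -scalemxAl -mulmxA qq mulmx1 /p scalerA divff ?gt_eqF//.
  by rewrite scale1r subrr.
have pB : p^T *m B = 0.
  by rewrite /B mulmxBr -scalemxAr mulmxA pp mul1mx pA subrr.
have qsubA : (q <= A)%MS.
  have -> : q = (a^-1 *: (q *m A^T)) *m A.
    by rewrite -scalemxAl -mulmxA qA scalerA mulVf// scale1r.
  exact: submxMl.
(* The row space of [B] lies in that of [A] but misses [q], since [B] kills [q^T] while [q *m q^T]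
   is 1. *)
have rkB : (\rank B < \rank A)%N.
  rewrite rank_ltmx// ltmxE; apply/andP; split.
    rewrite /B -scaleNr scalemxAl addmx_sub//.
    exact: submx_trans (submxMl _ _) qsubA.
  apply/negP => AB; have /submxP[w qE] := submx_trans qsubA AB.
  have := qq; rewrite {1}qE -mulmxA Bq mulmx0 => /matrixP/(_ 0 0)/eqP.
  by rewrite !mxE eqxx eq_sym oner_eq0.
have [r [P [s [Q [s0 [PP QQ _ BE]]]]]] := IH B (leq_trans rkB rkA).
have sn0 i : s 0 i != 0 by rewrite gt_eqF.
(* Cancelling the invertible [diag_mx s] transfers the annihilation by [q] and [p^T] from [B] to its
   singular vectors. *)
have Qq : Q^T *m q^T = 0.
  apply: (diag_mx_mul_eq0 sn0); move: Bq => /(congr1 (mulmx P^T)).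
  by rewrite mulmx0 BE !mulmxA PP mul1mx.
have Pp : P^T *m p = 0.
  apply: (diag_mx_mul_eq0 sn0); move: pB => /(congr1 (mulmx^~ Q)).
  rewrite mul0mx BE !mulmxA -(mulmxA _ Q^T) QQ mulmx1 => /(congr1 trmx).
  by rewrite !trmx_mul trmxK tr_diag_mx trmx0 mulmxA.
have pP : p^T *m P = 0 by rewrite -[LHS]trmxK trmx_mul trmxK Pp trmx0.
have qQ : q *m Q = 0 by rewrite -[LHS]trmxK trmx_mul Qq trmx0.
have s'0 i : 0 < row_mx s (const_mx c : 'rV_1) 0 i.
  by rewrite mxE; case: splitP => j _; rewrite // mxE.
exists (r + 1)%N, (row_mx P p), (row_mx s (const_mx c)), (row_mx Q q^T).
split=> //; split.
- by rewrite tr_row_mx mul_col_row PP Pp pP pp -scalar_mx_block.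
- by rewrite tr_row_mx trmxK mul_col_row QQ Qq qQ qq -scalar_mx_block.
- by move=> i; exact/ltW.
- rewrite diag_mx_row tr_row_mx trmxK mul_row_block !mulmx0 addr0 add0r.
  rewrite mul_row_col -BE diag_const_mx mul_mx_scalar -scalemxAl /B.
  by rewrite subrK.
Qed.

(** * Contractions and trace duality *)

Definition sqnorm (R : pzRingType) (n : nat) (x : 'cV[R]_n) : R :=
  (x^T *m x) 0 0.

Definition mx_contraction (R : realType) (m n : nat)
    (Z : 'M[R]_(m, n)) : Prop :=
  forall x : 'cV_n, sqnorm (Z *m x) <= sqnorm x.

Lemma sqnormE (R : pzRingType) (n : nat) (x : 'cV[R]_n) :
  sqnorm x = \sum_i x i 0 ^+ 2.
Proof. by rewrite /sqnorm mxE; apply: eq_bigr => i _; rewrite mxE -expr2. Qed.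

Lemma contraction_mul (R : realType) (m n p : nat) (Y : 'M[R]_(m, n))
    (Z : 'M[R]_(n, p)) :
  mx_contraction Y -> mx_contraction Z -> mx_contraction (Y *m Z).
Proof. by move=> cY cZ x; rewrite -mulmxA (le_trans (cY _)). Qed.

Lemma contraction_orthonormal (R : realType) (m r : nat) (P : 'M[R]_(m, r)) :
  P^T *m P = 1%:M -> mx_contraction P.
Proof.
by move=> PP x; rewrite /sqnorm trmx_mul mulmxA -(mulmxA _ P^T) PP mulmx1.
Qed.

(** Pythagoras for the orthogonal projection [P *m P^T]: the defect is the squared length of the
    residual. *)
Lemma contraction_trmx_orthonormal (R : realType) (m r : nat)
    (P : 'M[R]_(m, r)) :
  P^T *m P = 1%:M -> mx_contraction P^T.
Proof.
move=> PP x; rewrite -subr_ge0.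
suff -> : sqnorm x - sqnorm (P^T *m x) = sqnorm (x - P *m (P^T *m x)).
  by rewrite sqnormE sumr_ge0// => i _; exact: sqr_ge0.
rewrite /sqnorm [(_ - _)^T]linearB /= mulmxBl !mulmxBr !trmx_mul !trmxK !mulmxA.
by rewrite -(mulmxA _ P^T P) PP mulmx1 subrr subr0 !mxE.
Qed.

Lemma contraction_vsubmx (R : realType) (m1 m2 n : nat)
    (Z : 'M[R]_(m1 + m2, n)) :
  mx_contraction Z -> mx_contraction (usubmx Z) /\ mx_contraction (dsubmx Z).
Proof.
move=> cZ; have sqZ x : sqnorm (Z *m x) =
    sqnorm (usubmx Z *m x) + sqnorm (dsubmx Z *m x).
  rewrite -{1}(vsubmxK Z) mul_col_mx /sqnorm tr_col_mx mul_row_col.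
  by rewrite [LHS]mxE.
by split=> x; apply: le_trans (cZ x); rewrite sqZ ?lerDl ?lerDr sqnormE;
  apply: sumr_ge0 => i _; exact: sqr_ge0.
Qed.

(** The image of the [i]-th basis vector is column [i], whose squared length bounds the square of
    [M i i]. *)
Lemma contraction_diag_le1 (R : realType) (n : nat) (M : 'M[R]_n) (i : 'I_n) :
  mx_contraction M -> M i i <= 1.
Proof.
move=> /(_ (delta_mx i 0)); rewrite -colE !sqnormE (bigD1 i)//= mxE.
rewrite [leRHS](bigD1 i)//=.
rewrite [X in _ + X <= _](_ : _ = \sum_(j | j != i) M j i ^+ 2).
  rewrite [X in _ <= _ + X]big1 ?addr0 => [|j /negPf ji]; last first.
    by rewrite mxE ji expr0n.
  rewrite !mxE !eqxx expr1n => Mle; rewrite leNgt; apply/negP => M1.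
  have : 0 <= \sum_(j | j != i) M j i ^+ 2.
    by rewrite sumr_ge0// => j _; exact: sqr_ge0.
  by nra.
by apply: eq_bigr => j _; rewrite mxE.
Qed.

Lemma mxtrace_contraction_diag (R : realType) (n : nat) (M : 'M[R]_n)
    (s : 'rV[R]_n) :
  mx_contraction M -> (forall i, 0 <= s 0 i) ->
  \tr (M *m diag_mx s) <= \sum_i s 0 i.
Proof.
move=> cM s0; rewrite /mxtrace mul_mx_diag ler_sum// => i _.
by rewrite mxE ler_piMl// contraction_diag_le1.
Qed.

Lemma nuclear_norm_svd (R : realType) (m n r : nat) (A : 'M[R]_(m, n))
    (P : 'M[R]_(m, r)) (s : 'rV[R]_r) (Q : 'M[R]_(n, r)) :
  is_svd A P s Q -> nuclear_norm A = \sum_i s 0 i.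
Proof. exact: (sum_singular_value_svd (f := id)). Qed.

Lemma schatten_half_svd (R : realType) (m n r : nat) (A : 'M[R]_(m, n))
    (P : 'M[R]_(m, r)) (s : 'rV[R]_r) (Q : 'M[R]_(n, r)) :
  is_svd A P s Q -> schatten 2^-1 A = (\sum_i Num.sqrt (s 0 i)) ^+ 2.
Proof.
move=> svdA.
rewrite /schatten (sum_singular_value_svd (f := fun x => x `^ 2^-1) _ svdA).
  rewrite invrK powR_mulrn; last by rewrite sumr_ge0// => i _; exact: powR_ge0.
  congr (_ ^+ 2); apply: eq_bigr => i _.
  by rewrite powR12_sqrt//; case: svdA.
by rewrite powR0// invr_eq0 pnatr_eq0.
Qed.

(** By cyclicity the trace becomes that of [Q^T *m Z *m P] times a nonnegative diagonal matrix, and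
    the first factor is again a contraction. *)
Lemma mxtrace_contraction_le (R : realType) (m n : nat) (Z : 'M[R]_(n, m))
    (A : 'M[R]_(m, n)) :
  mx_contraction Z -> \tr (Z *m A) <= nuclear_norm A.
Proof.
move=> cZ; have [r [P [s [Q [_ svdA]]]]] := svd_exists A.
have [PP QQ s0 AE] := svdA.
rewrite (nuclear_norm_svd svdA) AE !mulmxA mxtrace_mulC !mulmxA.
apply: mxtrace_contraction_diag => //.
apply: contraction_mul (contraction_orthonormal PP).
exact: contraction_mul (contraction_trmx_orthonormal QQ) cZ.
Qed.

Lemma mxtrace_contraction_attained (R : realType) (m n : nat)
    (A : 'M[R]_(m, n)) :
  exists2 Z : 'M[R]_(n, m), mx_contraction Z & nuclear_norm A = \tr (Z *m A).
Proof.
have [r [P [s [Q [_ svdA]]]]] := svd_exists A.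
have [PP QQ s0 AE] := svdA; exists (Q *m P^T).
  apply: contraction_mul (contraction_trmx_orthonormal PP).
  exact: contraction_orthonormal.
rewrite (nuclear_norm_svd svdA) AE !mulmxA -(mulmxA Q) PP mulmx1.
by rewrite mxtrace_mulC mulmxA QQ mul1mx mxtrace_diag.
Qed.

(** A contraction attaining the left side splits into two stacked blocks, each a contraction to be
    tested against [A] or [B]. *)
Lemma nuclear_norm_row_mx (R : realType) (m n1 n2 : nat) (A : 'M[R]_(m, n1))
    (B : 'M[R]_(m, n2)) :
  nuclear_norm (row_mx A B) <= nuclear_norm A + nuclear_norm B.
Proof.
have [Z cZ ->] := mxtrace_contraction_attained (row_mx A B).
have [cu cd] := contraction_vsubmx cZ.
rewrite -(vsubmxK Z) mul_col_row mxtrace_block.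
by rewrite lerD// mxtrace_contraction_le.
Qed.

(** * The Schatten-1/2 value as the minimum over factorizations *)

Lemma schatten_half_le (R : realType) (m n d : nat) (U : 'M[R]_(m, d))
    (V : 'M[R]_(n, d)) :
  schatten 2^-1 (U *m V^T) <= nuclear_norm U * nuclear_norm V.
Proof.
have [r [P [s [Q [s_gt0 svdX]]]]] := svd_exists (U *m V^T).
have [r1 [P1 [s1 [Q1 [_ svdU]]]]] := svd_exists U.
have [PP QQ s_ge0 XE] := svdX; have [PP1 QQ1 s1_ge0 UE] := svdU.
(* [G^T *m G] is the polar factor H of [U]; factoring H turns its form into a sum of products, ready
   for Cauchy-Schwarz. *)
pose G := diag_mx (\row_i Num.sqrt (s1 0 i)) *m P1^T.
have GG : G^T *m G = P1 *m diag_mx s1 *m P1^T.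
  rewrite trmx_mul trmxK tr_diag_mx -!mulmxA; congr (_ *m _).
  rewrite mulmxA; congr (_ *m _).
  rewrite mul_diag_mx; apply/matrixP => i j; rewrite !mxE.
  by case: eqP => [->|]; rewrite ?mulr0// -expr2 sqr_sqrtr.
(* Here W is [P1 *m Q1^T], and column [i] of [Y] is y_i. *)
pose Y := P1 *m Q1^T *m V^T *m Q.
have GY : G^T *m (G *m Y) = P *m diag_mx s.
  rewrite mulmxA GG /Y !mulmxA -(mulmxA _ P1^T P1) PP1 mulmx1 -UE XE.
  by rewrite -(mulmxA _ Q^T Q) QQ mulmx1.
(* Diagonal entries: [T i i] is <p_i, H p_i> and [C i i] is <p_i, y_i>. *)
pose T := P^T *m (G^T *m (G *m P)); pose C := P^T *m Y.
have TE i : T i i = \sum_k (G *m P) k i ^+ 2.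
  rewrite /T (mulmxA P^T) -trmx_mul mxE; apply: eq_bigr => k _.
  by rewrite mxE -expr2.
have T_ge0 i : 0 <= T i i by rewrite TE sumr_ge0// => k _; exact: sqr_ge0.
have sE i : s 0 i = \sum_k (G *m P) k i * (G *m Y) k i.
  transitivity ((P^T *m (G^T *m (G *m Y))) i i).
    by rewrite GY mulmxA PP mul1mx mxE eqxx mulr1n.
  rewrite (mulmxA _^T G^T) -trmx_mul mxE; apply: eq_bigr => k _.
  by rewrite mxE.
have CE i : C i i * s 0 i = \sum_k (G *m Y) k i ^+ 2.
  transitivity ((Y^T *m (G^T *m (G *m Y))) i i).
    rewrite GY mulmxA mul_mx_diag [RHS]mxE; congr (_ * _).
    by rewrite /C -(trmxK Y) -trmx_mul !trmxK [LHS]mxE.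
  rewrite (mulmxA _^T G^T) -trmx_mul mxE; apply: eq_bigr => k _.
  by rewrite mxE -expr2.
have s_le i : s 0 i <= T i i * C i i.
  rewrite -(ler_pM2r (s_gt0 i)) -mulrA CE TE -expr2 {1}sE.
  exact: CauchySchwarz_sum.
(* The sign comes from [s_le]: a negative [C i i] would make [T i i * C i i] nonpositive, against
   [s 0 i > 0]. *)
have C_ge0 i : 0 <= C i i.
  rewrite leNgt; apply/negP => C_lt0.
  have := lt_le_trans (s_gt0 i) (s_le i).
  by rewrite ltNge mulr_ge0_le0// ltW.
have trT : \sum_i T i i <= nuclear_norm U.
  rewrite (nuclear_norm_svd svdU) -/(\tr T).
  have -> : \tr T = \tr (P1^T *m P *m (P^T *m P1) *m diag_mx s1).
    transitivity (\tr (P^T *m P1 *m diag_mx s1 *m (P1^T *m P))).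
      by rewrite /T [G^T *m _]mulmxA GG !mulmxA.
    by rewrite mxtrace_mulC !mulmxA.
  apply: mxtrace_contraction_diag => //; apply: contraction_mul.
    apply: contraction_mul (contraction_trmx_orthonormal PP1) _.
    exact: contraction_orthonormal.
  apply: contraction_mul (contraction_trmx_orthonormal PP) _.
  exact: contraction_orthonormal.
have trC : \sum_i C i i <= nuclear_norm V.
  rewrite -/(\tr C).
  (* Transposing first makes [V] appear in place of [V^T]. *)
  have -> : \tr C = \tr (Q1 *m P1^T *m (P *m Q^T) *m V).
    transitivity (\tr (Q^T *m V *m (Q1 *m P1^T *m P))).
      by rewrite -mxtrace_tr /C /Y !trmx_mul !trmxK !mulmxA.
    by rewrite mxtrace_mulC !mulmxA.
  apply: mxtrace_contraction_le; apply: contraction_mul.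
    apply: contraction_mul (contraction_orthonormal QQ1) _.
    exact: contraction_trmx_orthonormal.
  apply: contraction_mul (contraction_orthonormal PP) _.
  exact: contraction_trmx_orthonormal.
rewrite (schatten_half_svd svdX).
apply: le_trans (ler_pM _ _ trT trC); try exact: sumr_ge0.
apply: (@le_trans _ _ ((\sum_i Num.sqrt (T i i) * Num.sqrt (C i i)) ^+ 2)).
  rewrite ler_sqr ?nnegrE; [|exact: sumr_ge0|].
  2: by apply: sumr_ge0 => i _; rewrite mulr_ge0.
  by apply: ler_sum => i _; rewrite -sqrtrM// ler_wsqrtr.
apply: le_trans (CauchySchwarz_sum _ _) _.
rewrite le_eqVlt; apply/orP; left; apply/eqP; congr (_ * _);
  by apply: eq_bigr => i _; rewrite sqr_sqrtr.
Qed.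

(** The equality of the two nuclear norms is recorded for the quasi-triangle inequality, where it
    produces a perfect square. *)
Lemma schatten_half_factor (R : realType) (m n d : nat) (X : 'M[R]_(m, n)) :
  (\rank X <= d)%N ->
  exists (U : 'M[R]_(m, d)) (V : 'M[R]_(n, d)),
    [/\ X = U *m V^T, nuclear_norm U = nuclear_norm V
      & schatten 2^-1 X = nuclear_norm U ^+ 2].
Proof.
move=> rkX; have [r [P [s [Q [s_gt0 svdX]]]]] := svd_exists X.
have [PP QQ s_ge0 XE] := svdX.
(* [diag_mx s] is invertible and equals [P^T *m X *m Q], so [r] is at most the rank of [X]. *)
have rd : (r <= d)%N.
  apply: leq_trans rkX; rewrite -[leqLHS](mxrank_unit (A := diag_mx s)).
    have -> : diag_mx s = P^T *m X *m Q.
      by rewrite XE !mulmxA PP mul1mx -(mulmxA _ Q^T Q) QQ mulmx1.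
    exact: leq_trans (mxrankM_maxl _ _) (mxrankM_maxr _ _).
  rewrite unitmxE det_diag unitfE; apply/prodf_neq0 => i _.
  by rewrite gt_eqF.
(* Since [r <= d], this has orthonormal columns; its transpose pads the thin factors to [d]
   columns. *)
pose E : 'M[R]_(d, r) := pid_mx r.
have EE : E^T *m E = 1%:M.
  by rewrite tr_pid_mx pid_mx_id// pid_mx_1.
pose t := \row_i Num.sqrt (s 0 i).
have svdE k (O : 'M[R]_(k, r)) :
    O^T *m O = 1%:M -> is_svd (O *m diag_mx t *m E^T) O t E.
  by move=> OO; split=> // i; rewrite mxE sqrtr_ge0.
exists (P *m diag_mx t *m E^T), (Q *m diag_mx t *m E^T).
rewrite (nuclear_norm_svd (svdE _ _ PP)) (nuclear_norm_svd (svdE _ _ QQ)).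
split=> //; last first.
  rewrite (schatten_half_svd svdX); congr (_ ^+ 2).
  by apply: eq_bigr => i _; rewrite mxE.
rewrite !trmx_mul trmxK tr_diag_mx !mulmxA -(mulmxA _ E^T E) EE mulmx1 XE.
congr (_ *m _); rewrite -mulmxA; congr (_ *m _).
rewrite mul_diag_mx; apply/matrixP => i j; rewrite !mxE.
by case: eqP => [->|]; rewrite ?mulr0// -expr2 sqr_sqrtr.
Qed.

(** * Quasi-norm properties and conclusion *)

Lemma schatten_halfD (R : realType) (m n : nat) (X Y : 'M[R]_(m, n)) :
  schatten 2^-1 (X + Y) <= 2 * (schatten 2^-1 X + schatten 2^-1 Y).
Proof.
(* Both factorizations have inner dimension [n]; the concatenation has [n + n], which the lower
   bound accepts. *)
have [U1 [V1 [-> UV1 ->]]] := schatten_half_factor (rank_leq_col X).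
have [U2 [V2 [-> UV2 ->]]] := schatten_half_factor (rank_leq_col Y).
have nuc0 k l (A : 'M[R]_(k, l)) : 0 <= nuclear_norm A.
  by apply: sumr_ge0 => i _; exact: sqrtr_ge0.
rewrite -mul_row_col -tr_row_mx; apply: le_trans (schatten_half_le _ _) _.
apply: le_trans (ler_pM (nuc0 _ _ _) (nuc0 _ _ _)
  (nuclear_norm_row_mx _ _) (nuclear_norm_row_mx _ _)) _.
(* With u and v the nuclear norms of [U1] and [U2], what remains is (u + v)^2 <= 2 (u^2 + v^2). *)
rewrite -UV1 -UV2 -subr_ge0.
rewrite (_ : _ - _ = (nuclear_norm U1 - nuclear_norm U2) ^+ 2) ?sqr_ge0//.
by ring.
Qed.

Lemma schatten_half_eq0 (R : realType) (m n : nat) (X : 'M[R]_(m, n)) :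
  schatten 2^-1 X = 0 -> X = 0.
Proof.
have [r [P [s [Q [s_gt0 svdX]]]]] := svd_exists X.
rewrite (schatten_half_svd svdX) => /eqP; rewrite sqrf_eq0 psumr_eq0//.
move=> /allP s0; have [_ _ _ ->] := svdX.
rewrite (_ : diag_mx s = 0) ?mulmx0 ?mul0mx//.
(* Any index [i] would give an entry of [s] both zero and positive, so there is none. *)
apply/matrixP => i; have := s0 i; rewrite mem_index_enum sqrtr_eq0 leNgt s_gt0.
by move=> /(_ isT).
Qed.

Lemma schatten_halfZ (R : realType) (m n : nat) (a : R) (X : 'M[R]_(m, n)) :
  schatten 2^-1 (a *: X) = `|a| * schatten 2^-1 X.
Proof.
have [r [P [s [Q [_ svdX]]]]] := svd_exists X.
have [PP QQ s_ge0 XE] := svdX.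
(* [b] is a sign of [a], taken as 1 at 0; it is absorbed into [P] so that the scaled singular values
   stay nonnegative. *)
have [b bE bb] : exists2 b : R, a = b * `|a| & b * b = 1.
  case: (ger0P a) => _; first by exists 1; rewrite ?mul1r.
  by exists (-1); rewrite mulN1r opprK.
have svdaX : is_svd (a *: X) (b *: P) (`|a| *: s) Q.
  split=> //.
  - by rewrite [(_ *: _)^T]linearZ /= -scalemxAl -scalemxAr scalerA bb scale1r.
  - by move=> i; rewrite mxE mulr_ge0.
  - have -> : diag_mx (`|a| *: s) = `|a| *: diag_mx s by rewrite linearZ.
    by rewrite -scalemxAr -!scalemxAl scalerA mulrC -bE XE.
rewrite (schatten_half_svd svdX) (schatten_half_svd svdaX).
rewrite -{2}(sqr_sqrtr (normr_ge0 a)) -exprMn mulr_sumr; congr (_ ^+ 2).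
by apply: eq_bigr => i _; rewrite mxE sqrtrM.
Qed.

(** The inner dimension may vary with the matrix, since the infimum is attained at the same Schatten
    value for every admissible [d]. *)
Theorem theorem2 (R : realType) (m n : nat) :
  (forall d : 'M[R]_(m, n) -> nat,
     (forall X : 'M[R]_(m, n), (\rank X <= d X)%N) ->
     quasi_norm (fun X : 'M[R]_(m, n) => bin_norm (d X) X)) /\
  (forall (X : 'M[R]_(m, n)) (d : nat), (\rank X <= d)%N ->
     is_minimum (bin_products d X) (bin_norm d X) /\
     bin_norm d X = schatten 2^-1 X).
Proof.
have min_schatten (X : 'M[R]_(m, n)) d : (\rank X <= d)%N ->
    is_minimum (bin_products d X) (schatten 2^-1 X).
  move=> /schatten_half_factor[U [V [XE UV sE]]]; split.
    by exists U, V; split=> //; rewrite sE -UV expr2.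
  by move=> _ [U' [V' [-> ->]]]; exact: schatten_half_le.
have binE (X : 'M[R]_(m, n)) d : (\rank X <= d)%N ->
    bin_norm d X = schatten 2^-1 X.
  move=> /min_schatten[Ax lbx]; apply/eqP; rewrite eq_le; apply/andP; split.
    by apply: ge_inf => //; exists (schatten 2^-1 X).
  by apply: lb_le_inf => //; exists (schatten 2^-1 X).
split=> [d rkd|X d rkX]; last by rewrite binE//; split=> //; exact: min_schatten.
split=> [X|X|a X|].
- by rewrite binE//; exact: powR_ge0.
- by rewrite binE//; exact: schatten_half_eq0.
- by rewrite !binE//; exact: schatten_halfZ.
- exists 2; first by rewrite ler1n.
  by move=> X Y; rewrite !binE//; exact: schatten_halfD.
Qed.
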